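(* Let $X$ be a metric space. For every $m=1,2,\dots$, let $\mathscr{F}_m$ be the class of all nonempty compact subsets of $X$ with at most $m$ connected components. Then the function $K\mapsto\mathscr{H}^1(K)$ is lower semicontinuous on $\mathscr{F}_m$ endowed with the Hausdorff distance.
   Context: $\mathscr{H}^1$ is the one-dimensional Hausdorff measure on $X$, normalized as $\mathscr{H}^1(E)=\sup_{\delta>0}\inf\{\sum_i\operatorname{diam}(E_i)\}$, the infimum being over countable covers $\{E_i\}$ of $E$ by subsets of $X$ with $\operatorname{diam}(E_i)\le\delta$; it takes values in $[0,+\infty]$. The Hausdorff distance $d_H(E,E')$ is the infimum of all $r\ge0$ such that $\operatorname{dist}(x,E')\le r$ for every $x\in E$ and $\operatorname{dist}(x',E)\le r$ for every $x'\in E'$. $X$ is not assumed to be complete. *)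

(* Defs.v *)
From HB Require Import structures.
From mathcomp Require Import all_boot all_order all_algebra.
From mathcomp Require Import all_classical all_reals all_analysis.

Set Implicit Arguments.
Unset Strict Implicit.
Unset Printing Implicit Defensive.

Import Order.TTheory GRing.Theory Num.Theory.
Import numFieldNormedType.Exports.

Local Open Scope classical_set_scope.
Local Open Scope card_scope.
Local Open Scope ring_scope.

(* The point 0 is added so that the diameter of the empty set is 0 rather than
   -oo; it changes nothing for a nonempty set. *)
Definition diam (R : realType) (X : metricType R) (E : set X) : \bar R :=
  ereal_sup (0%E |` [set (mdist p.1 p.2)%:E | p in E `*` E]).

(* Since diam set0 = 0, sequences of sets also account for finite covers. *)
Definition delta_cover (R : realType) (X : metricType R) (delta : R)
    (E : set X) : set (nat -> set X) :=
  [set F | E `<=` \bigcup_i F i /\ forall i, (diam (F i) <= delta%:E)%E].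

Definition hausdorff_measure1 (R : realType) (X : metricType R) (E : set X) :
    \bar R :=
  ereal_sup [set ereal_inf [set (\sum_(0 <= i <oo) diam (F i))%E
                           | F in delta_cover delta E]
            | delta in [set delta : R | 0 < delta]].

(* Meaningful for nonempty E only. *)
Definition dist_to (R : realType) (X : metricType R) (x : X) (E : set X) : R :=
  inf [set mdist x y | y in E].

Definition hausdorff_radii (R : realType) (X : metricType R) (E E' : set X) :
    set R :=
  [set r | [/\ 0 <= r,
               forall x, E x -> dist_to x E' <= r
             & forall x', E' x' -> dist_to x' E <= r]].

(* Meaningful when E and E' are nonempty and bounded, so that the set of radii
   is nonempty: see hausdorff_radii_has_inf. *)
Definition hausdorff_dist (R : realType) (X : metricType R) (E E' : set X) : R :=
  inf (hausdorff_radii E E').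

Definition components (T : topologicalType) (K : set T) : set (set T) :=
  [set connected_component K x | x in K].

Record compact_components (R : realType) (X : metricType R) (m : nat) :=
  CompactComponents {
    cc_set :> set X ;
    cc_nonempty : cc_set !=set0 ;
    cc_compact : compact cc_set ;
    cc_components : components cc_set #<= `I_m
  }.

Lemma cc_set_inj (R : realType) (X : metricType R) (m : nat)
  (K K' : compact_components X m) : cc_set K = cc_set K' -> K = K'.
Proof.
case: K K' => [K n c l] [K' n' c' l'] /= KK'; subst K'.
by congr CompactComponents; exact: Prop_irrelevance.
Qed.

Lemma dist_to_has_inf (R : realType) (X : metricType R) (x : X) (E : set X) :
  E !=set0 -> has_inf [set mdist x y | y in E].
Proof.
move=> [y Ey]; split; first by exists (mdist x y), y.
by exists 0 => _ [z _ <-]; exact: mdist_ge0.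
Qed.

Lemma dist_to_le (R : realType) (X : metricType R) (x y : X) (E : set X) :
  E y -> dist_to x E <= mdist x y.
Proof.
move=> Ey; apply: ge_inf; last by exists y.
by case: (@dist_to_has_inf R X x E _) => //; exists y.
Qed.

Lemma dist_to_lt (R : realType) (X : metricType R) (x : X) (E : set X) (r : R) :
  E !=set0 -> dist_to x E < r -> exists2 y, E y & mdist x y < r.
Proof.
move=> E0 /inf_lt[|_ [y Ey <-] xyr]; first by case: (dist_to_has_inf x E0).
by exists y.
Qed.

Lemma hausdorff_radii_sym (R : realType) (X : metricType R) (E E' : set X) :
  hausdorff_radii E E' = hausdorff_radii E' E.
Proof. by apply/seteqP; split => r []. Qed.

Lemma compact_mdist_bounded (R : realType) (X : metricType R) (y : X)
  (E : set X) : compact E -> exists M, forall x, E x -> mdist x y <= M.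
Proof.
move=> /compact_near_coveringP /(_ R +oo (fun M x => mdist x y <= M) _) H.
have : \forall M \near +oo, E `<=` (fun x => mdist x y <= M).
  apply: H => x Ex.
  exists (ball x 1, [set M | 1 + mdist x y <= M]) => [|[z M] /= [xz]].
    by split => /=; [exact: nbhsx_ballx|apply: nbhs_pinfty_ge; exact: num_real].
  apply: le_trans; rewrite (le_trans (metric_triangle z x y))// lerD2r ltW//.
  by rewrite metric_sym; move: xz; rewrite ballEmdist.
by move=> /filter_ex[M EM]; exists M.
Qed.

Lemma hausdorff_radii_has_inf (R : realType) (X : metricType R)
  (E E' : set X) : E !=set0 -> E' !=set0 -> compact E -> compact E' ->
  has_inf (hausdorff_radii E E').
Proof.
move=> [a Ea] [b E'b] cE cE'; split; last by exists 0 => r [].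
have [M EM] := compact_mdist_bounded b cE.
have [N E'N] := compact_mdist_bounded a cE'.
exists (Num.max M N); split.
- by rewrite le_max (le_trans _ (EM _ Ea))// mdist_ge0.
- by move=> x Ex; rewrite le_max (le_trans (dist_to_le x E'b))// EM.
- by move=> x Ex; rewrite le_max (le_trans (dist_to_le x Ea) (E'N _ Ex)) orbT.
Qed.

Section compact_components_metric.
Context {R : realType} {X : metricType R} {m : nat}.
Implicit Types K : compact_components X m.

Let radii_inf K K' : has_inf (hausdorff_radii K K').
Proof.
by apply: hausdorff_radii_has_inf; try exact: cc_nonempty; exact: cc_compact.
Qed.

Let hdist_ge0 K K' : 0 <= hausdorff_dist K K'.
Proof. by apply: lb_le_inf => [|r []//]; case: (radii_inf K K'). Qed.

Let hdistxx K : hausdorff_dist K K = 0.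
Proof.
apply/eqP; rewrite eq_le hdist_ge0 andbT; apply: ge_inf.
  by case: (radii_inf K K).
by split => // x Kx; rewrite (le_trans (dist_to_le x Kx))// mdistxx.
Qed.

Let hdist_sym K K' : hausdorff_dist K K' = hausdorff_dist K' K.
Proof. by rewrite /hausdorff_dist hausdorff_radii_sym. Qed.

Let hdist0_sub K K' : hausdorff_dist K K' = 0 -> cc_set K `<=` cc_set K'.
Proof.
move=> KK' x Kx.
have /closure_id -> : closed (cc_set K').
  by apply: compact_closed; [exact: metric_hausdorff|exact: cc_compact].
move=> B /nbhs_ballP[e /= e0 eB].
have [r [r0 Kr _] re] : exists2 r, hausdorff_radii K K' r & r < e.
  apply: inf_lt; first by case: (radii_inf K K').
  by rewrite -/(hausdorff_dist K K') KK'.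
have [|y K'y xy] := dist_to_lt _ (le_lt_trans (Kr x Kx) re).
  exact: cc_nonempty.
by exists y; split => //; apply: eB; rewrite ballEmdist.
Qed.

Let hdist_positivity K K' : hausdorff_dist K K' = 0 -> K = K'.
Proof.
move=> KK'; apply: cc_set_inj; apply/seteqP; split; apply: hdist0_sub => //.
by rewrite hdist_sym.
Qed.

Let radii_triangle (A B C : set X) r s x : B !=set0 -> C !=set0 ->
  (forall x, A x -> dist_to x B <= r) -> (forall x, B x -> dist_to x C <= s) ->
  A x -> dist_to x C <= r + s.
Proof.
move=> B0 C0 AB BC Ax; apply/ler_addgt0Pl => e e0.
have e20 : 0 < e / 2 by rewrite divr_gt0.
have [|y By xy] := @dist_to_lt _ _ x B (r + e / 2) B0.
  by rewrite (le_lt_trans (AB x Ax))// ltrDl.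
have [|z Cz yz] := @dist_to_lt _ _ y C (s + e / 2) C0.
  by rewrite (le_lt_trans (BC y By))// ltrDl.
rewrite (le_trans (dist_to_le x Cz))// (le_trans (metric_triangle x y z))//.
by rewrite (le_trans (lerD (ltW xy) (ltW yz)))// addrACA -splitr addrC.
Qed.

Let hdist_triangle K' K K'' :
  hausdorff_dist K K'' <= hausdorff_dist K K' + hausdorff_dist K' K''.
Proof.
apply/ler_addgt0Pl => e e0; have e20 : 0 < e / 2 by rewrite divr_gt0.
have [r [r0 r1 r2] re] := inf_adherent e20 (radii_inf K K').
have [s [s0 s1 s2] se] := inf_adherent e20 (radii_inf K' K'').
apply: (@le_trans _ _ (r + s)).
  apply: ge_inf; first by case: (radii_inf K K'').
  have [nK nK' nK''] := And3 (cc_nonempty K) (cc_nonempty K') (cc_nonempty K'').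
  split; first exact: addr_ge0.
  - by move=> x; exact: (radii_triangle nK' nK'' r1 s1).
  - by move=> x; rewrite addrC; exact: (radii_triangle nK' nK s2 r2).
rewrite (le_trans (lerD (ltW re) (ltW se)))// addrACA -splitr addrC//.
Qed.

HB.instance Definition _ := gen_eqMixin (compact_components X m).
HB.instance Definition _ := gen_choiceMixin (compact_components X m).
HB.instance Definition _ := @isMetric.Build R (compact_components X m)
  (fun K K' => hausdorff_dist K K')
  hdistxx hdist_positivity hdist_sym hdist_triangle.

End compact_components_metric.

(* Main.v *)
(* If K is a compact set with finitely many components, H^1(K) is the supremum
   of the sums of the diameters of the finite disjoint families of continua
   contained in K.
   - These sums are at most H^1(K): a connected set is mapped by x |-> d(x0, x)
     onto an interval, so that its diameter is at most the sum of the diameters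
     of the sets of any countable cover.
   - Conversely, fix delta and a family s of continua of diameter at most
     delta / 2 whose sum is within e of the supremum of such sums. Outside a
     neighborhood of s, take a maximal set of points z such that the components
     of z in the discs of radius p are disjoint. By boundary bumping all but m
     of these components have diameter at least p; they can be added to s, so
     that the sum of their diameters is at most e. By maximality the discs of
     radius 2p cover the rest of K, hence H^1_delta(K) is at most the supremum,
     up to a multiple of e.
   Lower semicontinuity follows. Given a family s in K, let K' be close to K with
   H^1(K') <= a. In disjoint neighborhoods of radius r of the members of s, the
   components of K' which come close to s have diameter at least r / 2, except
   for m of them, so that their number is bounded in terms of a, r and m only.
   Since their union is e-dense along s, the sum of their diameters, which is at
   most H^1(K'), is at least the sum for s up to a term O(e). *)
Require Import Defs.
From mathcomp Require Import all_boot all_order all_algebra.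
From mathcomp Require Import all_classical all_reals all_analysis.
From mathcomp Require Import lra.

Set Implicit Arguments.
Unset Strict Implicit.
Unset Printing Implicit Defensive.

Import Order.TTheory GRing.Theory Num.Theory.
Import numFieldNormedType.Exports.

Local Open Scope classical_set_scope.
Local Open Scope card_scope.
Local Open Scope ring_scope.

(** * Relatively clopen sets and quasicomponents *)

(** The two clauses are those by which [connected] tests a subset of [M]. *)
Definition clopen_in (T : topologicalType) (M P : set T) :=
  (exists2 G, open G & P = M `&` G) /\ (exists2 C, closed C & P = M `&` C).

Lemma clopen_inI (T : topologicalType) (M P P' : set T) :
  clopen_in M P -> clopen_in M P' -> clopen_in M (P `&` P').
Proof.
move=> [[G oG PG] [C cC PC]] [[G' oG' PG'] [C' cC' PC']]; split.
  by exists (G `&` G'); [exact: openI|rewrite PG PG' setIACA setIid].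
by exists (C `&` C'); [exact: closedI|rewrite PC PC' setIACA setIid].
Qed.

Lemma clopen_in_self (T : topologicalType) (M : set T) : clopen_in M M.
Proof.
by split; exists setT; rewrite ?setIT//; (exact: openT || exact: closedT).
Qed.

Definition quasicomponent (T : topologicalType) (M : set T) (x : T) : set T :=
  \bigcap_(P in [set P | clopen_in M P /\ P x]) P.

Lemma quasicomponent_sub (T : topologicalType) (M : set T) (x : T) :
  M x -> quasicomponent M x `<=` M.
Proof. by move=> Mx y; apply; split => //; exact: clopen_in_self. Qed.

Lemma quasicomponent_closed (T : topologicalType) (M : set T) (x : T) :
  closed M -> closed (quasicomponent M x).
Proof.
by move=> cM; apply: closed_bigI => P [[_ [C cC ->]] _]; exact: closedI.
Qed.

(** Otherwise the traces outside [G] of the clopen sets [P] around [x] generate a proper filter on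
    the compact set [M]. A cluster point lies outside the open set [G] but in every [P], hence in
    the quasicomponent, a contradiction. *)
Lemma quasicomponent_sub_open (T : topologicalType) (M G : set T) (x : T) :
  compact M -> closed M -> M x -> open G -> quasicomponent M x `<=` G ->
  exists2 P, clopen_in M P /\ P x & P `<=` G.
Proof.
move=> cM clM Mx oG QO; apply: contrapT => nP.
pose F := filter_from [set P | clopen_in M P /\ P x] (fun P => P `\` G).
have FF : ProperFilter F.
  apply: filter_from_proper; last first.
    move=> P PP; apply/set0P/negP => /eqP; rewrite setD_eq0 => PG.
    by apply: nP; exists P.
  apply: filter_from_filter; first by exists M; split => //; exact: clopen_in_self.
  move=> P P' [cP Px] [cP' P'x]; exists (P `&` P').
    by split => //; exact: clopen_inI.
  by move=> y [[Py P'y] Oy].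
have FM : F M.
  by exists M; [split => //; exact: clopen_in_self|move=> y []].
have [y [My Fy]] := cM _ FF FM.
have FO P : clopen_in M P -> P x -> F (P `\` G) by exists P.
have nOy : ~ G y.
  have : closed (~` G) by exact: open_closedC.
  apply => B By; have [z [[_ Oz] Bz]] := Fy _ _ (FO _ (clopen_in_self M) Mx) By.
  by exists z.
apply/nOy/QO => P [cP Px].
have [_ [C cC PC]] := cP; have : closed P by rewrite PC; exact: closedI.
apply => B By; have [z [[Pz _] Bz]] := Fy _ _ (FO _ cP Px) By.
by exists z.
Qed.

Section metric_space.
Context {R : realType} {X : metricType R}.
Implicit Types (A B C E K M S V : set X) (x y z : X).

(** * Quasicomponents of compact sets and boundary bumping *)

Lemma metric_compact_closed K : compact K -> closed K.
Proof. by move=> cK; apply: compact_closed => //; exact: metric_hausdorff. Qed.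

Lemma quasicomponent_connected M x :
  compact M -> M x -> connected (quasicomponent M x).
Proof.
move=> cM Mx; have clM := metric_compact_closed cM.
have clQ := @quasicomponent_closed _ M x clM.
have Qx : quasicomponent M x x by move=> P [].
(* Disjoint closed sets cannot split the quasicomponent: normality puts them in disjoint open sets
   [U] and [W], some clopen [P] around [x] lies in their union, and the part of [P] in [U] is again
   clopen around [x]. *)
have key A B : closed A -> closed B -> A `&` B = set0 ->
    quasicomponent M x `<=` A `|` B -> A x -> quasicomponent M x `<=` A.
  move=> clA clB AB0 QAB Ax.
  have [U [W [oU oW AU BW UW0]]] :=
    (@normal_openP R X).1 pseudometric_normal A B clA clB AB0.
  have [P [cP Px] PUW] : exists2 P, clopen_in M P /\ P x & P `<=` U `|` W.
    apply: quasicomponent_sub_open => //; first exact: openU.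
    by apply: (subset_trans QAB); exact: setUSS.
  have PUcl : clopen_in M (P `&` U).
    have [[G oG PG] [C cC PC]] := cP; split.
      by exists (G `&` U); [exact: openI|rewrite PG setIA].
    (* Inside [P], intersecting with [U] amounts to removing [W], which gives a closed trace. *)
    exists (C `&` ~` W); first by apply: closedI => //; exact: open_closedC.
    rewrite setIA -PC; apply/seteqP; split => y [Py].
      by move=> Uy; split => // Wy; have : (U `&` W) y by []; rewrite UW0.
    by move=> Wy; split => //; case: (PUW _ Py).
  move=> y Qy; have [//|By] := QAB _ Qy.
  have [_ Uy] : (P `&` U) y by apply: Qy; split => //; split => //; exact: AU.
  by have : (U `&` W) y; [split => //; exact: BW|rewrite UW0].
move=> B [b Bb] [G oG BG] [C cC BC].
have clB : closed B by rewrite BC; exact: closedI.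
have clB' : closed (quasicomponent M x `\` B).
  rewrite BG setDIr setDv set0U; apply: closedI => //; exact: open_closedC.
have BQ : B `<=` quasicomponent M x by rewrite BC => y [].
have [Bx|nBx] := pselect (B x).
  apply/seteqP; split => //; apply: (key B _ clB clB') => //.
    by rewrite setDE setICA setICr setI0.
  by move=> y Qy; have [By|nBy] := pselect (B y); [left|right].
have /(_ b) : quasicomponent M x `<=` quasicomponent M x `\` B.
  apply: (key _ B clB' clB) => //.
    by rewrite setIC setDE setICA setICr setI0.
  by move=> y Qy; have [By|nBy] := pselect (B y); [right|left].
by case; [exact: BQ|move=> _ /(_ Bb)].
Qed.

(** The quasicomponent of [x] lies in the component, hence in the interior of [V], and so does some
    clopen [P] around [x]. Being away from the boundary of [V], this [P] is relatively open in all
    of [K], and closed, so it traps the component of [x] in [K]. *)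
Lemma boundary_bumping K V x :
  compact K -> closed V -> K x -> V x ->
  connected_component (K `&` V) x `<=` V° ->
  connected_component (K `&` V) x = connected_component K x.
Proof.
move=> cK clV Kx Vx CV.
have cM : compact (K `&` V) by exact: compact_closedI.
have clM := metric_compact_closed cM.
have Mx : (K `&` V) x by [].
have QC : quasicomponent (K `&` V) x `<=` connected_component (K `&` V) x.
  apply: connected_component_max; first by move=> P [].
    exact: quasicomponent_sub.
  exact: quasicomponent_connected.
have [P [[[G oG PG] [C cC PC]] Px] PV] :=
  quasicomponent_sub_open cM clM Mx (@open_interior _ V) (subset_trans QC CV).
have PK1 : P = K `&` (V° `&` G).
  rewrite setIA; apply/seteqP; split => y.
    move=> Py; have Vy := PV _ Py.
    by move: Py; rewrite PG => -[[Ky _] Oy].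
  by move=> [[Ky Vy] Oy]; rewrite PG; split => //; split => //; exact: interior_subset Vy.
have DP : connected_component K x `&` P = connected_component K x.
  have DK := @connected_component_sub _ K x.
  have Dx := connected_component_refl Kx.
  apply: (@component_connected _ K x); first by exists x.
    exists (V° `&` G); first by apply: openI => //; exact: open_interior.
    by rewrite PK1 setIA (setIidl DK).
  exists (V `&` C); first exact: closedI.
  by rewrite PC -setIA setIA (setIidl DK).
apply/seteqP; split; apply: connected_component_max.
- exact: connected_component_refl.
- by move=> y /connected_component_sub[].
- exact: component_connected.
- exact: connected_component_refl.
- by rewrite -DP => y [_]; rewrite PC => -[].
- exact: component_connected.
Qed.

(** * Diameters, neighborhoods and covers of connected sets *)

Lemma diam_ge0 A : (0 <= diam A)%E.
Proof. by apply: ereal_sup_ubound; left. Qed.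

Lemma mdist_le_diam A x y : A x -> A y -> ((mdist x y)%:E <= diam A)%E.
Proof. by move=> Ax Ay; apply: ereal_sup_ubound; right; exists (x, y). Qed.

Lemma diam_le A (e : \bar R) : (0 <= e)%E ->
  (forall x y, A x -> A y -> ((mdist x y)%:E <= e)%E) -> (diam A <= e)%E.
Proof.
by move=> e0 Ae; apply: ge_ereal_sup => _ [->//|[[x y] /= [Ax Ay] <-]]; exact: Ae.
Qed.

Lemma diamS A B : A `<=` B -> (diam A <= diam B)%E.
Proof.
move=> AB; apply: diam_le => [|x y Ax Ay]; first exact: diam_ge0.
by apply: mdist_le_diam; exact: AB.
Qed.

Lemma diam_set0 : diam (set0 : set X) = 0%E.
Proof. by apply/eqP; rewrite eq_le diam_ge0 andbT; exact: diam_le. Qed.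

Definition neighborhood A (e : R) : set X :=
  [set x | exists2 y, A y & mdist x y < e].

Lemma diam_neighborhood A (e : R) :
  0 <= e -> (diam (neighborhood A e) <= diam A + (e *+ 2)%:E)%E.
Proof.
move=> e0; apply: diam_le => [|x y [x' Ax' xx'] [y' Ay' yy']].
  by rewrite adde_ge0 ?diam_ge0// lee_fin mulrn_wge0.
rewrite (@le_trans _ _ (mdist x' y' + (e *+ 2))%:E)//.
  rewrite lee_fin (le_trans (metric_triangle x x' y))//.
  rewrite (le_trans (lerD (ltW xx') (metric_triangle x' y' y)))//.
  by rewrite metric_sym in yy'; rewrite addrCA lerD2l mulr2n lerD2l ltW.
by rewrite EFinD leeD2r// mdist_le_diam.
Qed.

Lemma open_neighborhood A (e : R) : open (neighborhood A e).
Proof.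
rewrite openE => x [y Ay xy]; apply/nbhs_ballP; exists (e - mdist x y) => /=.
  by rewrite subr_gt0.
move=> z; rewrite ballEmdist /= => xz; exists y => //.
rewrite (le_lt_trans (metric_triangle z x y))// -ltrBrDr.
by rewrite metric_sym.
Qed.

Lemma mdist_continuous x : continuous (mdist x : X -> R).
Proof.
move=> y; apply/cvgrPdist_le => e e0; near=> z.
have yz : mdist y z <= e.
  near: z; apply/nbhs_ballP; exists e => //= z.
  by rewrite ballEmdist => /ltW.
rewrite ler_distl lerBlDr; apply/andP; split.
  rewrite (le_trans (metric_triangle x y z))// lerD2l.
  exact: yz.
rewrite (le_trans (metric_triangle x z y))// lerD2l metric_sym.
exact: yz.
Unshelve. all: by end_near. Qed.

(** Images of arbitrary cover members need not be measurable, so they are enlarged to closed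
    intervals. The bound is extended because a cover member may be unbounded. *)
Lemma interval_enclosure (A : set R) (e : \bar R) : (0 <= e)%E ->
  (forall u v, A u -> A v -> ((u - v)%:E <= e)%E) ->
  exists J : set R, [/\ measurable J, A `<=` J & (lebesgue_measure J <= e)%E].
Proof.
move=> e0 Ae; have [[a Aa]|/nonemptyPn A0] := pselect (A !=set0); last first.
  by exists set0; split; [exact: measurable0|rewrite A0|rewrite measure0].
move: e e0 Ae => [r| |]// r0 Ar; last first.
  by exists setT; split; [exact: measurableT|by []|rewrite leey].
have {}Ar u v : A u -> A v -> u - v <= r by move=> Au Av; rewrite -lee_fin Ar.
have ubA : has_ubound A.
  by exists (a + r) => u Au; rewrite -lerBlDl Ar.
have lbA : has_lbound A.
  by exists (a - r) => u Au; rewrite lerBlDl -lerBlDr Ar.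
exists `[inf A, sup A]%classic; split => //.
  by move=> u Au /=; rewrite in_itv /= ge_inf//= ub_le_sup.
rewrite lebesgue_measure_itv /=; case: ifP => // _.
rewrite -EFinB lee_fin lerBlDr ge_sup//; first by exists a.
move=> u Au; rewrite addrC -lerBlDr lb_le_inf//; first by exists a.
by move=> v Av; rewrite lerBlDl -lerBlDr Ar.
Qed.

(* Push the cover to the real line with the 1-Lipschitz function [mdist x]. *)
Lemma connected_diam_le C (S : nat -> set X) : connected C ->
  C `<=` \bigcup_i S i -> (diam C <= \sum_(0 <= i <oo) diam (S i))%E.
Proof.
move=> cC CS; apply: diam_le => [|x y Cx Cy].
  by apply: nneseries_ge0 => i _ _; exact: diam_ge0.
have /choice[J HJ] (i : nat) : exists J : set R, [/\ measurable J,
    mdist x @` S i `<=` J & (lebesgue_measure J <= diam (S i))%E].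
  apply: interval_enclosure; first exact: diam_ge0.
  move=> _ _ [u Su <-] [v Sv <-].
  apply: le_trans (mdist_le_diam Sv Su).
  by rewrite lee_fin lerBlDl metric_triangle.
have itv : is_interval (mdist x @` C).
  apply/connected_intervalP/connected_continuous_connected => //.
  exact/continuous_subspaceT/mdist_continuous.
have sub : `[0, mdist x y] `<=` \bigcup_i J i.
  move=> t /=; rewrite in_itv /= => t0.
  have C0 : (mdist x @` C) 0 by exists x => //; rewrite mdistxx.
  have [z Cz <-] : (mdist x @` C) t by apply: itv t0 => //; exists y.
  have [i _ Siz] := CS _ Cz; exists i => //.
  by have [_ + _] := HJ i; apply; exists z.
have : (lebesgue_measure `[0%R, mdist x y] <=
    \sum_(0 <= i <oo) lebesgue_measure (J i))%E.
  by apply: measure_sigma_subadditive => // i; have [] := HJ i.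
rewrite lebesgue_measure_itv /= lte_fin oppr0 adde0.
case: ltP => [_|d0 _].
  move=> /le_trans; apply; apply: lee_nneseries => // i _.
  by have [] := HJ i.
rewrite (_ : mdist x y = 0); last by apply/eqP; rewrite eq_le d0 mdist_ge0.
by apply: nneseries_ge0 => i _ _; exact: diam_ge0.
Qed.

Lemma nneseries_nth (T : Type) (f : T -> \bar R) (t0 : T) (s : seq T) :
  (forall t, 0 <= f t)%E -> f t0 = 0%E ->
  (\sum_(0 <= i <oo) f (nth t0 s i) = \sum_(t <- s) f t)%E.
Proof.
move=> f0 ft0; rewrite (@nneseries_split _ _ 0 (size s))// add0n.
rewrite eseries0 ?adde0 => [|i si _]; last by rewrite nth_default.
by rewrite [RHS](big_nth t0).
Qed.

Lemma connected_diam_le_seq C (s : seq (set X)) : connected C ->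
  (forall x, C x -> exists2 A, A \in s & A x) ->
  (diam C <= \sum_(A <- s) diam A)%E.
Proof.
move=> cC Cs; rewrite -(nneseries_nth s diam_ge0 diam_set0).
apply: connected_diam_le => // x /Cs[A As Ax].
by exists (index A s) => //; rewrite nth_index.
Qed.

(** * Disjoint families of continua and their sums of diameters *)

Definition disjoint_seq (s : seq (set X)) :=
  pairwise (fun A B => `[< A `&` B = set0 >]) s.

Lemma compact_separated A B : compact A -> closed B -> A `&` B = set0 ->
  exists2 d : R, 0 < d & forall a b, A a -> B b -> d <= mdist a b.
Proof.
move=> /compact_near_coveringP
  /(_ R 0^'+ (fun d a => forall b, B b -> d <= mdist a b) _) + clB AB0 => H.
have : \forall d \near 0^'+, A `<=` (fun a => forall b, B b -> d <= mdist a b).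
  apply: H => x Ax.
  have /nbhs_ballP[e /= e0 eB] : nbhs x (~` B).
    apply: open_nbhs_nbhs; split; first exact: closed_openC.
    by move=> Bx; have : (A `&` B) x by []; rewrite AB0.
  (* [B] misses the ball of radius [e] at [x], so points within [e / 2] of [x] stay at distance at
     least [e / 2] from [B]. *)
  exists (ball x (e / 2), [set d | d <= e / 2]) => [|[z d] /= [xz de] b Bb].
    by split => /=; [apply: nbhsx_ballx; rewrite divr_gt0|
      apply: nbhs_right_le; rewrite divr_gt0].
  rewrite (le_trans de)// -(lerD2l (e / 2)) -splitr.
  rewrite (@le_trans _ _ (mdist x b))//.
    by rewrite leNgt; apply/negP => xb; apply: (eB b) => //; rewrite ballEmdist.
  rewrite (le_trans (metric_triangle x z b))// lerD2r ltW//.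
  by move: xz; rewrite ballEmdist.
move=> AnB; have H0 : \forall d \near 0^'+, (0 < d :> R) /\
    A `<=` (fun a => forall b, B b -> d <= mdist a b).
  by apply: filterI => //; exact: nbhs_right_gt.
have [|d [d0 dA]] := filter_ex H0; first exact: at_right_proper_filter.
by exists d => // a b Aa; exact: dA.
Qed.

Lemma seq_common_radius (T : eqType) (s : seq T) (P : T -> R -> Prop) :
  (forall t d d', d' <= d -> P t d -> P t d') ->
  (forall t, t \in s -> exists2 d : R, 0 < d & P t d) ->
  exists2 d : R, 0 < d & forall t, t \in s -> P t d.
Proof.
move=> Pmono; elim: s => [|t s ih] Ps; first by exists 1.
have [d d0 dP] := Ps t (mem_head _ _).
have [u us|d' d'0 d'P] := ih; first by apply: Ps; rewrite in_cons us orbT.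
exists (Num.min d d'); first by rewrite lt_min d0.
move=> u; rewrite in_cons => /orP[/eqP ->|us].
  by apply: Pmono dP; rewrite ge_min lexx.
by apply: Pmono (d'P _ us); rewrite ge_min lexx orbT.
Qed.

Lemma disjoint_seq_separated (s : seq (set X)) :
  disjoint_seq s -> (forall A, A \in s -> compact A) ->
  exists2 d : R, 0 < d & pairwise
    (fun A B => `[< forall a b, A a -> B b -> d <= mdist a b >]) s.
Proof.
elim: s => [_ _|A s ih /= /andP[/allP As ds] cs]; first by exists 1.
have [B Bs|d d0 dP] := ih ds; first by apply: cs; rewrite in_cons Bs orbT.
have [|B Bs|d' d'0 d'P] := @seq_common_radius _ s
    (fun B d => forall a b, A a -> B b -> d <= mdist a b).
- by move=> B u v vu H a b Aa Bb; rewrite (le_trans vu)// H.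
- apply: compact_separated; first by apply: cs; rewrite mem_head.
    by apply: metric_compact_closed; apply: cs; rewrite in_cons Bs orbT.
  by apply/asboolP; exact: As.
exists (Num.min d d'); first by rewrite lt_min d0.
apply/andP; split.
  apply/allP => B Bs; apply/asboolP => a b Aa Bb.
  by rewrite ge_min (d'P _ Bs) ?orbT.
apply: sub_pairwise dP => B C /asboolP H; apply/asboolP => b c Bb Cc.
by rewrite ge_min H.
Qed.

(** A set of diameter less than [d] meets at most one member of [s], so at most one term is
    nonzero. *)
Lemma sum_diam_setI_le (s : seq (set X)) (d : R) B :
  pairwise (fun A A' => `[< forall a b, A a -> A' b -> d <= mdist a b >]) s ->
  (diam B < d%:E)%E -> (\sum_(A <- s) diam (B `&` A) <= diam B)%E.
Proof.
move=> + Bd; elim: s => [_|A s ih /= /andP[/allP As ds]].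
  by rewrite big_nil diam_ge0.
rewrite big_cons; have [[a [Ba Aa]]|/nonemptyPn ->] := pselect (B `&` A !=set0).
  rewrite big_seq big1 ?adde0; first by apply: diamS => x [].
  move=> A' A's; rewrite (_ : _ `&` _ = set0) ?diam_set0//.
  rewrite -subset0 => b [Bb A'b].
  have /asboolP/(_ _ _ Aa A'b) := As _ A's.
  by apply/negP; rewrite -ltNge -lte_fin (le_lt_trans _ Bd)// mdist_le_diam.
by rewrite diam_set0 add0e ih.
Qed.

Definition disjoint_continua K (s : seq (set X)) := disjoint_seq s /\
  forall A, A \in s -> [/\ compact A, connected A, A !=set0 & A `<=` K].

(** With [d] a separation of the members, take covers by sets of diameter at most [d / 2], hence
    less than [d]. Their traces cover each member, and each cover set is charged to one member
    only. *)
Lemma sum_diam_le_hausdorff_measure1 K (s : seq (set X)) : disjoint_continua K s ->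
  (\sum_(A <- s) diam A <= hausdorff_measure1 K)%E.
Proof.
move=> [ds sK]; have [A /sK[]//|d d0 dP] := disjoint_seq_separated ds.
apply: (@le_trans _ _ (ereal_inf [set (\sum_(0 <= i <oo) diam (F i))%E
    | F in delta_cover (d / 2) K])); last first.
  by apply: ereal_sup_ubound; exists (d / 2) => //=; rewrite divr_gt0.
apply: le_ereal_inf_tmp => _ [F [KF Fd] <-].
apply: (@le_trans _ _ (\sum_(A <- s) \sum_(0 <= i <oo) diam (F i `&` A))%E).
  rewrite big_seq [leRHS]big_seq; apply: lee_sum => A /sK[_ cA _ AK].
  apply: connected_diam_le => // x Ax; have [i _ Fix] := KF _ (AK _ Ax).
  by exists i.
rewrite -nneseries_sum; last by move=> *; exact: diam_ge0.
apply: lee_nneseries => [i _ _|i _].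
  by apply: sume_ge0 => *; exact: diam_ge0.
apply: sum_diam_setI_le dP _; rewrite (le_lt_trans (Fd i))// lte_fin.
by rewrite ltr_pdivrMr// mulr2n mulrDr mulr1 ltrDl.
Qed.

(** * Counting disjoint sets and choosing maximal families *)

Lemma disjoint_seq_uniq (s : seq (set X)) :
  disjoint_seq s -> (forall A, A \in s -> A !=set0) -> uniq s.
Proof.
elim: s => // A s ih /= /andP[/allP As ds] s0; apply/andP; split.
  apply/negP => /As /asboolP; rewrite setIid => A0.
  by have [a] := s0 A (mem_head _ _); rewrite A0.
by apply: ih => // B Bs; apply: s0; rewrite in_cons Bs orbT.
Qed.

Lemma size_components_le K (m : nat) (s : seq (set X)) :
  components K #<= `I_m -> uniq s -> (forall A, A \in s -> components K A) ->
  (size s <= m)%N.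
Proof.
move=> Km us sK; have fK : finite_set (components K).
  by apply/finite_set_leP; exists m.
apply: leq_trans (geq_card_fset_set Km); apply: uniq_leq_size => // A /sK KA.
by rewrite in_fset_set// inE.
Qed.

Lemma sum_ge_const (s : seq (set X)) (p : R) :
  (forall A, A \in s -> (p%:E <= diam A)%E) ->
  ((p *+ size s)%:E <= \sum_(A <- s) diam A)%E.
Proof.
elim: s => [_|A s ih sp]; first by rewrite big_nil mulr0n.
rewrite big_cons /= mulrS EFinD leeD ?sp ?mem_head//.
by apply: ih => B Bs; rewrite sp// in_cons Bs orbT.
Qed.

(** At most [m] members are components of [K]; each of the others contributes at least [p] to the
    sum. *)
Lemma size_disjoint_seq_le K (m : nat) (s : seq (set X)) (p : R) :
  components K #<= `I_m -> 0 <= p -> disjoint_seq s ->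
  (forall A, A \in s -> A !=set0 /\ ((p%:E <= diam A)%E \/ components K A)) ->
  ((p *+ size s)%:E <= \sum_(A <- s) diam A + (p *+ m)%:E)%E.
Proof.
move=> Km p0 ds sP.
pose q : pred (set X) := fun A => `[< components K A >].
have us : uniq s by apply: disjoint_seq_uniq => // A /sP[].
rewrite -(count_predC q) addnC mulrnDr EFinD leeD//.
  rewrite -size_filter (@le_trans _ _ (\sum_(A <- seq.filter (predC q) s) diam A)%E)//.
    apply: sum_ge_const => A; rewrite mem_filter => /andP[/= qA /sP[_ [//|KA]]].
    by move: qA; rewrite /q asboolT.
  rewrite big_filter big_mkcond; apply: lee_sum => A _.
  by case: ifP => // _; exact: diam_ge0.
rewrite lee_fin ler_wpMn2l// -size_filter.
apply: size_components_le Km _ _; first exact: filter_uniq.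
by move=> A; rewrite mem_filter => /andP[/asboolP].
Qed.

Lemma maximal_disjoint_seq (I : eqType) (D : set I) (c : I -> set X) (N : nat) :
  (forall r : seq I, (forall i, i \in r -> D i) ->
    disjoint_seq [seq c i | i <- r] -> (size r <= N)%N) ->
  exists r : seq I, [/\ forall i, i \in r -> D i,
    disjoint_seq [seq c i | i <- r] &
    forall i, D i -> exists2 j, j \in r & c i `&` c j !=set0].
Proof.
move=> rN.
pose P n := `[< exists r : seq I, [/\ size r = n, forall i, i \in r -> D i &
    disjoint_seq [seq c i | i <- r]] >].
have P0 : exists n, P n by exists 0%N; apply/asboolP; exists [::].
have PN n : P n -> (n <= N)%N by move=> /asboolP[r [<- rD dr]]; exact: rN.
case: (ex_maxnP P0 PN) => n /asboolP[r [rn rD dr]] nmax.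
exists r; split => // i Di; apply: contrapT => nj.
have /nmax : P n.+1; last by rewrite ltnn.
apply/asboolP; exists (i :: r); split; first by rewrite /= rn.
  by move=> j; rewrite in_cons => /orP[/eqP ->//|]; exact: rD.
apply/andP; split => //; apply/allP => _ /mapP[j jr ->]; apply/asboolP.
by apply/nonemptyPn => ij; apply: nj; exists j.
Qed.

(** The bound on sums of diameters bounds the sizes of disjoint families, so a largest one exists.
    It is applied to components in small balls for the upper bound of the measure, and to components
    in neighborhoods of continua for the lower bound. *)
Lemma maximal_disjoint_continua K (m : nat) (I : eqType) (D : set I)
    (c : I -> set X) (p b : R) : components K #<= `I_m -> 0 < p ->
  (forall i, D i ->
    c i !=set0 /\ ((p%:E <= diam (c i))%E \/ components K (c i))) ->
  (forall r : seq I, (forall i, i \in r -> D i) ->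
    disjoint_seq [seq c i | i <- r] -> (\sum_(i <- r) diam (c i) <= b%:E)%E) ->
  exists r : seq I, [/\ forall i, i \in r -> D i,
    disjoint_seq [seq c i | i <- r],
    forall i, D i -> exists2 j, j \in r & c i `&` c j !=set0 &
    p *+ size r <= b + p *+ m].
Proof.
move=> Km p0 cD rb.
have size_le (r : seq I) : (forall i, i \in r -> D i) ->
    disjoint_seq [seq c i | i <- r] -> p *+ size r <= b + p *+ m.
  move=> rD dr; rewrite -lee_fin EFinD -(size_map c).
  apply: (@le_trans _ _ (\sum_(A <- map c r) diam A + (p *+ m)%:E)%E).
    apply: size_disjoint_seq_le Km (ltW p0) dr _.
    by move=> _ /mapP[i ir ->]; apply: cD; exact: rD.
  by rewrite leeD2r// big_map rb.
pose N := Num.bound ((b + p *+ m) / p).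
have [r rD dr|r [rD dr rmax]] := @maximal_disjoint_seq I D c N.
  have := size_le r rD dr; rewrite -mulr_natr mulrC -ler_pdivlMr// => rle.
  have : 0 <= (b + p *+ m) / p by exact: le_trans rle.
  move=> /archi_boundP /(le_lt_trans rle).
  by rewrite ltr_nat => /ltnW.
by exists r; split => //; exact: size_le.
Qed.

(** * Components inside closed sets and balls *)

Lemma component_continuum K V x : compact K -> closed V -> K x -> V x ->
  [/\ compact (connected_component (K `&` V) x),
    connected (connected_component (K `&` V) x),
    connected_component (K `&` V) x x &
    connected_component (K `&` V) x `<=` K `&` V].
Proof.
move=> cK clV Kx Vx; have cKV : compact (K `&` V) by exact: compact_closedI.
split.
- apply: (subclosed_compact _ cKV); last exact: connected_component_sub.
  by apply: component_closed; exact: metric_compact_closed cKV.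
- exact: component_connected.
- exact: connected_component_refl.
- exact: connected_component_sub.
Qed.

(** Either the component stays in the interior of [V] and boundary bumping applies, or it joins [x]
    to a point outside that interior. *)
Lemma component_diam_ge K V x (p : R) : compact K -> closed V -> K x -> V x ->
  (forall y, ~ V° y -> p <= mdist x y) ->
  (p%:E <= diam (connected_component (K `&` V) x))%E \/
  components K (connected_component (K `&` V) x).
Proof.
move=> cK clV Kx Vx pV.
have [CV|] := pselect (connected_component (K `&` V) x `<=` V°).
  by right; exists x => //; apply/esym; exact: boundary_bumping.
move=> /existsNP[y /not_implyP[Cy /pV xy]]; left.
have Cx : connected_component (K `&` V) x x by exact: connected_component_refl.
by apply: le_trans (mdist_le_diam Cx Cy); rewrite lee_fin.
Qed.

Definition cball x (p : R) : set X := [set y | mdist x y <= p].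

Lemma closed_cball x (p : R) : closed (cball x p).
Proof.
apply: (closed_comp (f := mdist x) (D := [set t | t <= p])) => [y _|].
  exact: mdist_continuous.
exact: closed_le.
Qed.

Lemma interior_cball x y (p : R) :
  ~ (cball x p)° y -> p <= mdist x y.
Proof.
apply: contra_notP => /negP; rewrite -ltNge => xy.
apply/nbhs_ballP; exists (p - mdist x y) => /=; first by rewrite subr_gt0.
move=> z; rewrite ballEmdist /= ltrBrDl => /ltW yz.
exact: le_trans (metric_triangle x y z) _.
Qed.

Lemma diam_cball x (p : R) :
  0 <= p -> (diam (cball x p) <= (p *+ 2)%:E)%E.
Proof.
move=> p0; apply: diam_le => [|y z /= xy xz]; first by rewrite lee_fin mulrn_wge0.
rewrite lee_fin (le_trans (metric_triangle y x z))// mulr2n lerD//.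
by rewrite metric_sym.
Qed.

(** * Upper bound of the measure by sums over disjoint continua *)

Lemma sum_leDconst (I : eqType) (r : seq I) (f g : I -> \bar R) (d : R) :
  (forall i, i \in r -> (f i <= g i + d%:E)%E) ->
  (\sum_(i <- r) f i <= \sum_(i <- r) g i + (d *+ size r)%:E)%E.
Proof.
elim: r => [_|i r ih fg]; first by rewrite !big_nil add0e mulr0n.
rewrite !big_cons /= mulrS EFinD addeACA leeD ?fg ?mem_head//.
by apply: ih => j jr; rewrite fg// in_cons jr orbT.
Qed.

Lemma disjoint_seq_cat (s t : seq (set X)) : disjoint_seq s -> disjoint_seq t ->
  (forall A B, A \in s -> B \in t -> A `&` B = set0) -> disjoint_seq (s ++ t).
Proof.
move=> ds dt st; rewrite /disjoint_seq pairwise_cat; apply/and3P; split => //.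
by apply/allrelP => A B As Bt; apply/asboolP; exact: st.
Qed.

Lemma ereal_inf_cover_le K (d : R) (s : seq (set X)) :
  0 <= d -> (forall x, K x -> exists2 A, A \in s & A x) ->
  (forall A, A \in s -> (diam A <= d%:E)%E) ->
  (ereal_inf [set (\sum_(0 <= i <oo) diam (F i))%E | F in delta_cover d K] <=
   \sum_(A <- s) diam A)%E.
Proof.
move=> d0 Ks sd; apply: ereal_inf_lbound; exists (fun i => nth set0 s i); last first.
  exact: nneseries_nth diam_ge0 diam_set0.
split=> [x /Ks[A As Ax]|i]; first by exists (index A s) => //; rewrite nth_index.
have [si|si] := ltnP i (size s); first by rewrite sd// mem_nth.
by rewrite nth_default// diam_set0 lee_fin.
Qed.

Lemma disjoint_continua_fill K (s r : seq (set X)) : disjoint_continua K s ->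
  disjoint_continua K r -> (forall A B, A \in s -> B \in r -> A `&` B = set0) ->
  disjoint_continua K (s ++ r).
Proof.
move=> [ds sK] [dr rK] sr; split; first exact: disjoint_seq_cat.
by move=> A; rewrite mem_cat => /orP[/sK|/rK].
Qed.

(* Near-maximality of the family [s] among families of small pieces leaves only
   room for discs of total diameter O(e) outside a neighborhood of [s]. *)
Lemma cover_outside K (m : nat) (s : seq (set X)) (h p e : R) :
  compact K -> components K #<= `I_m -> 0 < p -> p < h ->
  disjoint_continua K s ->
  (forall r, disjoint_continua K (s ++ r) ->
    (forall A, A \in r -> (diam A <= (p *+ 2)%:E)%E) ->
    (\sum_(A <- r) diam A <= e%:E)%E) ->
  exists2 r : seq X, p *+ size r <= e + p *+ m &
    forall x, K x -> (exists2 A, A \in s & neighborhood A h x) \/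
                     (exists2 z, z \in r & cball z (p *+ 2) x).
Proof.
move=> cK Km p0 ph sK se.
pose D := [set z | K z /\ forall A, A \in s -> ~ neighborhood A h z].
pose c z := connected_component (K `&` cball z p) z.
have zz z : cball z p z by rewrite /cball /= mdistxx ltW.
have cD z : D z -> [/\ compact (c z), connected (c z), c z z &
    c z `<=` K `&` cball z p].
  by move=> [Kz _]; apply: component_continuum => //; exact: closed_cball.
have [|r rD dr|r [rD dr rmax rp]] :=
    @maximal_disjoint_continua K m X D c p e Km p0.
- move=> z Dz; have [_ _ czz _] := cD z Dz; split; first by exists z.
  have [Kz _] := Dz; apply: component_diam_ge => //; first exact: closed_cball.
  by move=> y; exact: interior_cball.
- rewrite -(big_map c xpredT (fun A => diam A)); apply: se.
    apply: disjoint_continua_fill => //.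
      split => // _ /mapP[z /rD Dz ->]; have [? ? ? cK'] := cD z Dz.
      by split => //; [exists z|move=> y /cK'[]].
    move=> A _ As /mapP[z /rD Dz ->]; rewrite -subset0 => y [Ay].
    have [_ _ _ /[apply] [[_ zy]]] := cD z Dz.
    (* Since [p < h], a disc around a point of [D] cannot reach a member of [s]. *)
    by have [_ /(_ A As)] := Dz; apply; exists y => //; exact: le_lt_trans ph.
  move=> _ /mapP[z /rD Dz ->]; have [_ _ _ cK'] := cD z Dz.
  apply: le_trans (diam_cball z (ltW p0)); apply: diamS.
  by move=> y /cK'[].
exists r => // x Kx.
have [Dx|] := pselect (D x); last first.
  move=> /not_andP[//|/existsNP[A /not_implyP[As /contrapT xA]]].
  by left; exists A.
(* By maximality the pieces at [x] and at some chosen [z] share a point [y], within [p] of both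
   centers. *)
right; have [z zr [y [xy zy]]] := rmax _ Dx; exists z => //.
have [_ _ _ /(_ _ xy)[_ {}xy]] := cD x Dx.
have [_ _ _ /(_ _ zy)[_ {}zy]] := cD z (rD z zr).
rewrite /cball /= (le_trans (metric_triangle z y x))// mulr2n lerD//.
by rewrite metric_sym.
Qed.

Lemma hausdorff_measure1_le_sum_diam K (m : nat) (a : R) :
  compact K -> components K #<= `I_m ->
  (forall s, disjoint_continua K s -> (\sum_(A <- s) diam A <= a%:E)%E) ->
  (hausdorff_measure1 K <= a%:E)%E.
Proof.
move=> cK Km Ka; apply: ge_ereal_sup => _ [d /= d0 <-].
apply/lee_addgt0Pr => e6 e60.
(* One share of [e] pays for fattening [s]. The discs take five: if [n] is their number, then
   [4pn <= 4(e + pm) <= 5e]. *)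
pose e := e6 / 6%:R; have e0 : 0 < e by rewrite divr_gt0.
(* Members of diameter at most [d / 2] can be fattened by [h] and still be admissible in a cover at
   scale [d]. *)
pose small (s : seq (set X)) := disjoint_continua K s /\
  forall A, A \in s -> (diam A <= (d / 2)%:E)%E.
set sums := [set (\sum_(A <- s) diam A)%E | s in small].
have sup_ge0 : (0 <= ereal_sup sums)%E.
  by apply: ereal_sup_ubound; exists [::]; rewrite ?big_nil.
have sup_le : (ereal_sup sums <= a%:E)%E.
  by apply: ge_ereal_sup => _ [s [sK _] <-]; exact: Ka.
have sup_fin : ereal_sup sums \is a fin_num.
  by rewrite ge0_fin_numE// (le_lt_trans sup_le)// ltry.
have [_ [s [sK sd] <-] sup_s] := ub_ereal_sup_adherent e0 sup_fin.
(* The first bound keeps the fattened members below diameter [d]; the second makes the total cost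
   [2h] per member at most [e]. The successor avoids dividing by zero when [s] is empty. *)
pose h := Num.min (d / 4%:R) (e / (size s).*2.+1%:R).
have h0 : 0 < h by rewrite lt_min !divr_gt0.
have hd : h *+ 2 <= d / 2.
  have : h <= d / 4%:R by rewrite ge_min lexx.
  by lra.
have hs : (h *+ 2) *+ size s <= e.
  rewrite -mulrnA mul2n -mulr_natr.
  apply: (@le_trans _ _ (h * (size s).*2.+1%:R)).
    by rewrite ler_wpM2l ?(ltW h0)// ler_nat.
  by rewrite -ler_pdivlMr// ge_min lexx orbT.
(* The first bound gives [p < h] and keeps the discs of radius [2p] below diameter [d]; the second
   gives [4pm <= e]. *)
pose p := Num.min (h / 2) (e / (4 * m).+1%:R).
have p0 : 0 < p by rewrite lt_min !divr_gt0.
have ph : p <= h / 2 by rewrite ge_min lexx.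
have pm : (p *+ 4) *+ m <= e.
  rewrite -mulrnA -mulr_natr.
  apply: (@le_trans _ _ (p * (4 * m).+1%:R)).
    by rewrite ler_wpM2l ?(ltW p0)// ler_nat.
  by rewrite -ler_pdivlMr// ge_min lexx orbT.
have [|r srK rp|r rp rcov] := @cover_outside K m s h p e cK Km p0 _ sK.
- by lra.
(* The extended family is still small, so its sum is at most the supremum, which exceeds the sum
   over [s] by less than [e]. Cancelling the latter requires it to be finite. *)
- have /= := @ereal_sup_ubound _ sums (\sum_(A <- s ++ r) diam A)%E.
  have sr : sums (\sum_(A <- s ++ r) diam A)%E.
    exists (s ++ r) => //; split => // A.
    rewrite mem_cat => /orP[/sd//|/rp/le_trans]; apply.
    by rewrite lee_fin; lra.
  move=> /(_ sr); rewrite big_cat /= => srle.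
  have sfin : (\sum_(A <- s) diam A)%E \is a fin_num.
    rewrite ge0_fin_numE; last by apply: sume_ge0 => *; exact: diam_ge0.
    by rewrite (le_lt_trans (Ka s sK))// ltry.
  rewrite -(leeD2lE _ _ sfin) (le_trans srle)// -leeBlDr//.
  exact: ltW.
pose t := [seq neighborhood A h | A <- s] ++ [seq cball z (p *+ 2) | z <- r].
apply: (@le_trans _ _ (\sum_(A <- t) diam A)%E).
  apply: ereal_inf_cover_le; first exact: ltW.
    move=> x /rcov[[A As xA]|[z zr xz]].
      exists (neighborhood A h) => //; rewrite mem_cat; apply/orP; left.
      by apply/mapP; exists A.
    exists (cball z (p *+ 2)) => //; rewrite mem_cat; apply/orP; right.
    by apply/mapP; exists z.
  move=> B; rewrite mem_cat => /orP[|] /mapP[A As ->].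
    rewrite (le_trans (diam_neighborhood A (ltW h0)))//.
    rewrite (le_trans (leeD2r _ (sd A As)))// -EFinD lee_fin; lra.
  rewrite (le_trans (diam_cball A _))// ?mulrn_wge0 ?(ltW p0)// lee_fin.
  lra.
rewrite big_cat /= !big_map.
have sle : (\sum_(A <- s) diam (neighborhood A h) <= a%:E + e%:E)%E.
  apply: (@le_trans _ _ (\sum_(A <- s) diam A + ((h *+ 2) *+ size s)%:E)%E).
    by apply: sum_leDconst => A As; exact/diam_neighborhood/ltW.
  by rewrite leeD ?Ka// lee_fin.
have rle : (\sum_(z <- r) diam (cball z (p *+ 2)) <= (5 * e)%:E)%E.
  apply: (@le_trans _ _ (\sum_(z <- r) 0 + ((p *+ 4) *+ size r)%:E)%E).
    apply: sum_leDconst => z zr; rewrite add0e.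
    by rewrite (le_trans (diam_cball z _)) ?mulrn_wge0 ?(ltW p0)// -mulrnA.
  rewrite big1// add0e lee_fin.
  have : (p *+ 4) *+ size r = 4 * (p *+ size r) by rewrite mulrnAC mulr_natl.
  have : (p *+ 4) *+ m = 4 * (p *+ m) by rewrite mulrnAC mulr_natl.
  by lra.
rewrite (le_trans (leeD sle rle))// -!EFinD lee_fin.
by rewrite /e; lra.
Qed.

(** * Lower bound of the measure for nearby compact sets *)

Lemma pairwise_neq (T : eqType) (e : rel T) (s : seq T) (x y : T) :
  symmetric e -> pairwise e s -> x \in s -> y \in s -> x != y -> e x y.
Proof.
move=> esym; elim: s => // z s ih /= /andP[/allP zs es].
rewrite !in_cons => /orP[/eqP ->|xs] /orP[/eqP ->|ys] xy.
- by rewrite eqxx in xy.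
- exact: zs.
- by rewrite esym; exact: zs.
- exact: ih.
Qed.

Lemma closure_neighborhood_sub A (r : R) : 0 < r ->
  closure (neighborhood A r) `<=` neighborhood A (r *+ 2).
Proof.
move=> r0 x /(_ _ (nbhsx_ballx x r r0))[y [[z Az yz]]].
rewrite ballEmdist /= => xy; exists z => //.
by rewrite (le_lt_trans (metric_triangle x y z))// mulr2n ltrD.
Qed.

(** A common point would be within less than [2r] of both [A] and [B], against their separation by
    [4r]. *)
Lemma closure_neighborhood_disjoint (s : seq (set X)) (r : R) A B x : 0 < r ->
  pairwise (fun A B => `[< forall a b, A a -> B b -> r *+ 4 <= mdist a b >]) s ->
  A \in s -> B \in s -> closure (neighborhood A r) x ->
  closure (neighborhood B r) x -> A = B.
Proof.
move=> r0 rs As Bs /(closure_neighborhood_sub r0)[a Aa xa].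
move=> /(closure_neighborhood_sub r0)[b Bb xb]; apply/eqP/negP => /negP AB.
have sym : symmetric (fun A B : set X =>
    `[< forall a b, A a -> B b -> r *+ 4 <= mdist a b >]).
  by move=> C E; apply/asboolP/asboolP => H c d Cc Ed; rewrite metric_sym; exact: H.
have /asboolP/(_ _ _ Aa Bb) := pairwise_neq sym rs As Bs AB.
apply/negP; rewrite -ltNge (le_lt_trans (metric_triangle a x b))//.
by rewrite (mulrnDr r 2 2) ltrD// metric_sym.
Qed.

(** Each member of [s] is covered by the fattened pieces that [t] assigns to it. After exchanging
    the sums, each piece is counted once because [s] has no repetition. *)
Lemma sum_diam_sub_neighborhood (I : eqType) (s : seq (set X)) (r : seq I)
    (t : I -> set X) (c : I -> set X) (e : R) : 0 <= e -> uniq s ->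
  (forall A, A \in s -> connected A) -> (forall i, i \in r -> t i \in s) ->
  (forall A x, A \in s -> A x ->
    exists2 i, i \in r & t i = A /\ neighborhood (c i) e x) ->
  (\sum_(A <- s) diam A <= \sum_(i <- r) diam (c i) + (e *+ 2 *+ size r)%:E)%E.
Proof.
move=> e0 us cs ts st.
apply: (@le_trans _ _ (\sum_(A <- s) \sum_(i <- r | t i == A)
    diam (neighborhood (c i) e))%E).
  rewrite big_seq [leRHS]big_seq; apply: lee_sum => A As.
  rewrite -big_filter -(big_map (fun i => neighborhood (c i) e) xpredT (fun B => diam B)).
  apply: connected_diam_le_seq => [|x Ax]; first exact: cs.
  have [i ir [tiA xi]] := st A x As Ax; exists (neighborhood (c i) e) => //.
  by apply/mapP; exists i => //; rewrite mem_filter tiA eqxx.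
rewrite (exchange_big_dep xpredT)//=.
apply: (@le_trans _ _ (\sum_(i <- r) diam (neighborhood (c i) e))%E).
  rewrite big_seq [leRHS]big_seq; apply: lee_sum => i ir.
  rewrite (eq_bigl (pred1 (t i))); last by move=> A /=; rewrite eq_sym.
  by rewrite -big_filter filter_pred1_uniq ?ts// big_seq1.
by apply: sum_leDconst => i _; exact: diam_neighborhood.
Qed.

(** If the measure of [K] were at most [a], the number of disjoint pieces of [K] near [s] would be
    bounded independently of [K]. So [e] can be fixed in advance, small enough that fattening them
    all costs no more than a slack [f]. *)
Lemma disjoint_continua_lower_bound K0 (m : nat) (s : seq (set X)) (a : R) :
  disjoint_continua K0 s -> (a%:E < \sum_(A <- s) diam A)%E ->
  exists2 e : R, 0 < e & forall K, compact K -> components K #<= `I_m ->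
    K0 `<=` neighborhood K e -> (a%:E < hausdorff_measure1 K)%E.
Proof.
move=> [ds sK0] as_.
have us : uniq s by apply: disjoint_seq_uniq => // A /sK0[].
have [A /sK0[]//|d d0 dP] := disjoint_seq_separated ds.
pose r := d / 4%:R; have r0 : 0 < r by rewrite divr_gt0.
have {}dP : pairwise (fun A B => `[< forall a b, A a -> B b ->
    r *+ 4 <= mdist a b >]) s.
  apply: sub_pairwise dP => A B /asboolP H; apply/asboolP => x y Ax By.
  by apply: le_trans (H x y Ax By); rewrite /r; lra.
have [f f0 af] : exists2 f : R, 0 < f & ((a + f)%:E < \sum_(A <- s) diam A)%E.
  move: as_; case: (\sum_(A <- s) diam A)%E => [u| |]//; last first.
    by exists 1 => //; rewrite ltry.
  rewrite lte_fin => au; exists ((u - a) / 2); first by rewrite divr_gt0// subr_gt0.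
  by rewrite lte_fin; lra.
(* A point within [p] of a point that is [e]-close to [A], with [e <= r / 2], is still in the open
   [r]-neighborhood of [A]. *)
pose p := r / 2; have p0 : 0 < p by rewrite divr_gt0.
(* This bounds [p] times the number of pieces; the absolute value keeps it nonnegative. The choice
   of [e] then makes the cost of [2e] per piece at most [f]. *)
pose b := `|a| + p *+ m; have b0 : 0 <= b by rewrite addr_ge0// mulrn_wge0// ltW.
pose e := Num.min (r / 2) (f * p / (b *+ 2 + 1)).
have b1 : 0 < b *+ 2 + 1 by rewrite ltr_wpDl// mulrn_wge0.
have e0 : 0 < e by rewrite lt_min divr_gt0// divr_gt0// mulr_gt0.
have er : e <= r / 2 by rewrite ge_min lexx.
have eb : e * (b *+ 2) <= f * p.
  apply: (@le_trans _ _ (e * (b *+ 2 + 1))).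
    by rewrite ler_wpM2l ?(ltW e0)// lerDl.
  by rewrite -ler_pdivlMr// ge_min lexx orbT.
exists e => // K cK Km K0K; rewrite ltNge; apply/negP => Ka.
pose V A := closure (neighborhood A r).
(* A pair records the member of [s] along with the nearby point of [K], since the piece is cut out
   by the neighborhood of that member. *)
pose D := [set q : set X * X | [/\ q.1 \in s, K q.2 & neighborhood q.1 e q.2]].
pose c (q : set X * X) := connected_component (K `&` V q.1) q.2.
have VD q : D q -> V q.1 q.2.
  move=> [_ _ [x qx xe]]; apply: subset_closure; exists x => //.
  by rewrite (lt_le_trans xe)// (le_trans er)//; lra.
have cD q : D q -> [/\ compact (c q), connected (c q), c q q.2 &
    c q `<=` K `&` V q.1].
  move=> Dq; have [_ Kq _] := Dq; apply: component_continuum => //.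
    exact: closed_closure.
  exact: VD.
have ca (q : seq (set X * X)) : (forall i, i \in q -> D i) ->
    disjoint_seq [seq c i | i <- q] -> (\sum_(i <- q) diam (c i) <= a%:E)%E.
  move=> qD dq; rewrite -(big_map c xpredT (fun A => diam A)) (le_trans _ Ka)//.
  apply: sum_diam_le_hausdorff_measure1; split => // _ /mapP[i /qD Di ->].
  have [? ? ? cK'] := cD i Di; split => //; first by exists i.2.
  by move=> y /cK'[].
have [|q qD dq|Z [ZD dZ Zmax Zp]] :=
    @maximal_disjoint_continua K m _ D c p a Km p0.
- move=> q Dq; have [_ _ cq _] := cD q Dq; split; first by exists q.2.
  have [qs Kq [x qx qxe]] := Dq.
  apply: component_diam_ge => //; [exact: closed_closure|exact: VD|].
  move=> y nVy; rewrite leNgt; apply/negP => qy; apply: nVy.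
  have : neighborhood q.1 r y.
    exists x => //; rewrite (le_lt_trans (metric_triangle y q.2 x))//.
    by rewrite metric_sym (lt_le_trans (ltrD qy qxe))// /p; lra.
  move: y {qy}; rewrite -/(_ `<=` _) -open_subsetE; last exact: open_neighborhood.
  exact: subset_closure.
- exact: ca.
suff : (\sum_(A <- s) diam A <= (a + f)%:E)%E by rewrite leNgt af.
apply: (@le_trans _ _ (\sum_(q <- Z) diam (c q) + (e *+ 2 *+ size Z)%:E)%E).
  apply: (@sum_diam_sub_neighborhood _ s Z fst) => //; first exact: ltW.
  - by move=> A /sK0[].
  - by move=> q /ZD[].
  - move=> A x As Ax; have [_ _ _ AK0] := sK0 A As.
    have [y Ky xy] := K0K x (AK0 _ Ax).
    have Dy : D (A, y) by split => //=; exists x => //; rewrite metric_sym.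
    have [q qZ [w [yw qw]]] := Zmax _ Dy; exists q => //.
    have Dq := ZD q qZ; have [qs _ _] := Dq.
    have [_ _ _ /(_ _ yw)[_ /= VAw]] := cD _ Dy.
    have [_ _ _ /(_ _ qw)[_ /= Vqw]] := cD _ Dq.
    (* The common point [w] lies in both closed neighborhoods, so the two pieces belong to the same
       member. They are then components of one set sharing [w], hence equal, and the piece of [q]
       contains [y]. *)
    have qA : q.1 = A by exact: closure_neighborhood_disjoint r0 dP qs As Vqw VAw.
    split => //; exists y => //.
    rewrite /c qA (same_connected_component (y := w)).
      by apply: connected_component_sym; exact: yw.
    by move: qw; rewrite /c qA.
rewrite EFinD leeD ?ca//.
rewrite lee_fin -(ler_pM2r p0) (le_trans _ eb)//.
have -> : e *+ 2 *+ size Z * p = e * ((p *+ size Z) *+ 2).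
  by rewrite !mulrnAl !mulrnAr mulrnAC.
rewrite ler_wpM2l ?(ltW e0)// lerMn2r (le_trans Zp)// lerD2r ler_norm//.
Qed.

End metric_space.

(** * Lower semicontinuity for the Hausdorff distance *)

Theorem theorem2p9 (R : realType) (X : metricType R) (m : nat)
    (hm : (0 < m)%N) :
  lower_semicontinuous
    (fun K : compact_components X m => hausdorff_measure1 (cc_set K)).
Proof.
move=> K a /= aK.
have [s sK sa] : exists2 s, disjoint_continua (cc_set K) s &
    (a%:E < \sum_(A <- s) diam A)%E.
  (* If no family had sum above [a], the upper bound would give a measure of at most [a]. *)
  apply: contrapT => ns; move: aK; rewrite ltNge => /negP; apply.
  apply: hausdorff_measure1_le_sum_diam (cc_components K) _.
    exact: cc_compact.
  by move=> s sK; rewrite leNgt; apply/negP => sa; apply: ns; exists s.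
have [e e0 eP] := disjoint_continua_lower_bound m sK sa.
exists (ball K e) => [|K']; first exact: nbhsx_ballx.
rewrite ballEmdist /= => KK'.
apply: eP; [exact: cc_compact|exact: cc_components|move=> x Kx].
have [r [_ Kr _] re] : exists2 r, hausdorff_radii K K' r & r < e.
  apply: inf_lt KK'; apply: (hausdorff_radii_has_inf _ _ _ _).1;
    by [exact: cc_nonempty|exact: cc_compact].
exact: dist_to_lt (cc_nonempty K') (le_lt_trans (Kr x Kx) re).
Qed.
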